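(* Let $n\ge1$ be an integer. The $\mathfrak{osp}(1|2n)$-action on $\mathbb{C}[x_1,\ldots,x_n]\otimes\mathbb{C}^{1|0}$ obtained by conjugating the tensor product representation $\rho\otimes\tau$ on $\mathbb{C}[x_1,\ldots,x_n]\otimes\mathbb{C}^{1|2n}$ by ${}^{w_2}\Gamma$ and restricting, i.e. $X\cdot u=({}^{w_2}\Gamma)^{-1}\big((\rho\otimes\tau)(X)\,{}^{w_2}\Gamma(u)\big)$, is characterized by the following formulas, for $1\le j\le n$ and $k_1,\ldots,k_n\in\mathbb{Z}_{\ge0}$: $$X_j\big(x_1^{k_1}x_2^{k_2}\cdots x_n^{k_n}\otimes v_0\big)=-\frac1{\sqrt2}\,x_1^{k_1}\cdots x_j^{k_j+1}\cdots x_n^{k_n}\otimes v_0,$$ $$X_{-j}\big(x_1^{k_1}x_2^{k_2}\cdots x_n^{k_n}\otimes v_0\big)=-\frac1{\sqrt2}\,k_j\,x_1^{k_1}\cdots x_j^{k_j-1}\cdots x_n^{k_n}\otimes v_0.$$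
   Context: All vector spaces are over $\mathbb{C}$; $|\cdot|$ denotes parity in $\mathbb{Z}/2\mathbb{Z}$. A term with coefficient $k_j=0$ is zero. $\mathbb{C}^{1|2n}$ has homogeneous basis $v_0$ (even), $v_1,\ldots,v_{2n}$ (odd); $\mathbb{C}^{1|0}=\mathbb{C}v_0$. The Lie superalgebra $\mathfrak{osp}(1|2n)\subset\mathfrak{gl}(1|2n)$ consists of the block matrices $\begin{bmatrix}0&r\\c&A\end{bmatrix}$ with $r=(r_1,\ldots,r_{2n})$, $c^{\intercal}=(r_{n+1},\ldots,r_{2n},-r_1,\ldots,-r_n)$, $A\in\mathfrak{sp}(2n)$, with the supercommutator bracket; $A$ gives the even part and $(r,c)$ the odd part. The inclusion is the natural representation $\tau$ on $\mathbb{C}^{1|2n}$. As a Lie superalgebra it is generated by the odd root vectors $X_{\pm j}$ ($1\le j\le n$), where $T_{\pm j}=\tau(X_{\pm j})$ acts by $T_jv_0=v_j$, $T_jv_{n+j}=v_0$, $T_{-j}v_0=-v_{n+j}$, $T_{-j}v_j=v_0$, and zero on all other basis vectors. The oscillator representation $\rho$ on $\mathbb{C}[x_1,\ldots,x_n]$ (parity of a monomial = its total degree mod 2) is determined by $\rho(X_j)=\tfrac1{\sqrt2}x_j$, $\rho(X_{-j})=\tfrac1{\sqrt2}\partial_{x_j}$. The tensor product representation $\rho\otimes\tau$ is $X(f\otimes v)=\rho(X)f\otimes v+(-1)^{|X||f|}f\otimes\tau(X)v$ for homogeneous $X,f$. The operator ${}^{w_2}\Gamma$ is the linear automorphism of $\mathbb{C}[x_1,\ldots,x_n]\otimes\mathbb{C}^{1|2n}$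 $${}^{w_2}\Gamma=\mathbf{1}\otimes\mathbf{1}+\sqrt2\sum_{i=1}^n\partial_{x_i}\otimes T_i-\sqrt2\sum_{i=1}^nx_i\otimes T_{-i},$$ where, by the super sign rule, $(D\otimes T_{\pm i})(f\otimes v)=(-1)^{|f|}D(f)\otimes T_{\pm i}v$ for homogeneous $f$ and $D\in\{x_i,\partial_{x_i}\}$. It maps $\mathbb{C}[x_1,\ldots,x_n]\otimes\mathbb{C}^{1|0}$ onto an $\mathfrak{osp}(1|2n)$-submodule. *)

(* Defs.v *)
From mathcomp Require Export all_boot all_order all_algebra.
From mathcomp Require Export reals.
From mathcomp Require Export complex mpoly.

Set Implicit Arguments.
Unset Strict Implicit.
Unset Printing Implicit Defensive.

Import GRing.Theory Num.Theory.

Local Open Scope ring_scope.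

(* The definitions are over any C : numClosedFieldType; the complex numbers are
   the instance C := R[i] with R : realType. *)

Section BasisOfC12n.
Variable n : nat.

(* Positions of v_0, v_j and v_{n+j} (1 <= j <= n, here j : 'I_n) among the
   1 + 2n coordinates. *)
Definition ix0 : 'I_(1 + (n + n)) := lshift (n + n) ord0.
Definition ixl (j : 'I_n) : 'I_(1 + (n + n)) := rshift 1 (lshift n j).
Definition ixr (j : 'I_n) : 'I_(1 + (n + n)) := rshift 1 (rshift n j).

(* v_0 is even, the other basis vectors are odd; true stands for odd. *)
Definition ixpar (i : 'I_(1 + (n + n))) : bool := i != ix0.

End BasisOfC12n.

Arguments ix0 {n}.

Section Osp.
Variables (C : numClosedFieldType) (n : nat).

Local Notation gl := 'M[C]_(1 + (n + n)).

Definition symplJ : 'M[C]_(n + n) := block_mx 0 1%:M (- 1%:M) 0.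

Definition is_sp (A : 'M[C]_(n + n)) : Prop := A^T *m symplJ + symplJ *m A = 0.

Definition osp_mx (r : 'rV[C]_(n + n)) (A : 'M[C]_(n + n)) : gl :=
  block_mx 0 r (row_mx (rsubmx r) (- lsubmx r))^T A.

Definition is_osp (X : gl) : Prop := exists r A, is_sp A /\ X = osp_mx r A.

Definition gl_even (X : gl) : gl := block_mx (ulsubmx X) 0 0 (drsubmx X).
Definition gl_odd (X : gl) : gl := block_mx 0 (ursubmx X) (dlsubmx X) 0.

Definition gl_homog (p : bool) (X : gl) : Prop :=
  X = if p then gl_odd X else gl_even X.

(* The supercommutator of X and Y homogeneous of parities p and q. *)
Definition sbracket (p q : bool) (X Y : gl) : gl :=
  X *m Y - (-1) ^+ (p && q) *: (Y *m X).

(* X_j and X_{-j}; the osp inclusion being tau, these are also T_j, T_{-j}.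
   delta_mx a b maps the b-th basis vector to the a-th one. *)
Definition Xpos (j : 'I_n) : gl := delta_mx (ixl j) ix0 + delta_mx ix0 (ixr j).
Definition Xneg (j : 'I_n) : gl := - delta_mx (ixr j) ix0 + delta_mx ix0 (ixl j).

(* act is a representation of osp(1|2n) on the subspace W of V, where par p is
   the set of vectors of V homogeneous of parity p.  The values of act outside
   of osp(1|2n) and W are irrelevant. *)
Record osp_rep (V : lmodType C) (par : bool -> V -> Prop) (W : V -> Prop)
    (act : gl -> V -> V) : Prop := OspRep {
  osp_rep_stable : forall X u, is_osp X -> W u -> W (act X u);
  osp_rep_linearl : forall (a : C) X Y u, is_osp X -> is_osp Y -> W u ->
    act (a *: X + Y) u = a *: act X u + act Y u;
  osp_rep_linearr : forall (a : C) X u v, is_osp X -> W u -> W v ->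
    act X (a *: u + v) = a *: act X u + act X v;
  osp_rep_parity : forall p q X u, is_osp X -> gl_homog p X -> W u -> par q u ->
    par (p (+) q) (act X u);
  osp_rep_bracket : forall p q X Y u, is_osp X -> is_osp Y ->
    gl_homog p X -> gl_homog q Y -> W u ->
    act (sbracket p q X Y) u =
      act X (act Y u) - (-1) ^+ (p && q) *: act Y (act X u) }.

End Osp.

Arguments Xpos {C n} j.
Arguments Xneg {C n} j.

(* C[x_1, ..., x_n] (x) C^{1|2n}, with \sum_i f_i (x) v_i encoded by the
   family of its coordinates f_i. *)
Notation tensor C n := {ffun 'I_(1 + (n + n)) -> {mpoly C[n]}}.

Section TensorProduct.
Variables (C : numClosedFieldType) (n : nat).

Local Notation gl := 'M[C]_(1 + (n + n)).
Local Notation poly := {mpoly C[n]}.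

Definition poly_homog (p : bool) (f : poly) : Prop :=
  forall m : 'X_{1..n}, m \in msupp f -> odd (mdeg m) = p.

(* The linear operator f |-> (-1)^|f| f. *)
Definition poly_sign (f : poly) : poly :=
  \sum_(m <- msupp f) ((-1) ^+ mdeg m * f@_m) *: 'X_[m].

Definition tens (f : poly) (v : 'cV[C]_(1 + (n + n))) : tensor C n :=
  [ffun i => v i 0 *: f].

Definition tensor_homog (p : bool) (u : tensor C n) : Prop :=
  forall i, poly_homog (p (+) ixpar i) (u i).

Definition v0 : 'cV[C]_(1 + (n + n)) := delta_mx ix0 0.

(* C[x_1, ..., x_n] (x) C^{1|0}. *)
Definition tensor10 (u : tensor C n) : Prop := exists f, u = tens f v0.

(* D (x) T for D linear and T homogeneous of parity p:
   (D (x) T) (f (x) v) = (-1)^(p |f|) D f (x) T v. *)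
Definition tens_op (p : bool) (D : poly -> poly) (T : gl) (u : tensor C n) : tensor C n :=
  [ffun i => \sum_j T i j *: D (if p then poly_sign (u j) else u j)].

Definition is_oscillator (rho : gl -> poly -> poly) : Prop :=
  [/\ osp_rep poly_homog (fun _ => True) rho,
      forall j f, rho (Xpos j) f = (sqrtC 2)^-1 *: ('X_j * f) &
      forall j f, rho (Xneg j) f = (sqrtC 2)^-1 *: mderiv j f].

(* rho (x) tau, with tau (X) = X split into its homogeneous components. *)
Definition tens_rep (rho : gl -> poly -> poly) (X : gl) (u : tensor C n) : tensor C n :=
  tens_op false (rho X) 1%:M u
  + tens_op false id (gl_even X) u + tens_op true id (gl_odd X) u.

Definition Gamma_w2 (u : tensor C n) : tensor C n :=
  u + sqrtC 2 *: (\sum_(i < n) tens_op true (mderiv i) (Xpos i) u)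
    - sqrtC 2 *: (\sum_(i < n) tens_op true (fun f => 'X_i * f) (Xneg i) u).

(* The action conjugated by Gamma_w2, given the inverse Gi of Gamma_w2. *)
Definition conj_act (rho : gl -> poly -> poly) (Gi : tensor C n -> tensor C n)
    (X : gl) (u : tensor C n) : tensor C n :=
  Gi (tens_rep rho X (Gamma_w2 u)).

End TensorProduct.

Arguments v0 {C n}.
Arguments Gamma_w2 {C n} u.
Arguments tensor_homog {C n} p u.
Arguments tensor10 {C n} u.
Arguments poly_homog {C n} p f.

(* Main.v *)
(* With E = vac, e = excite and a = relax, the operator Gamma_w2 has the form
   u |-> u + sqrt 2 (e u_0 + E (a u)), where u_0 is the v_0-coordinate of u,
   E f = f (x) v_0,
   e : f |-> sum_k (d_k s f (x) v_k + x_k s f (x) v_{n+k}), s being the parity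
   involution of polynomials, and a is a linear map to polynomials vanishing on
   the image of E. As a e = - n, solving for the v_0-coordinate amounts to
   dividing by 1 + 2n, so Gamma_w2 is invertible; it is even because s
   anticommutes with x_k and d_k. On the vacuum line
   Gamma_w2 (E f) = E f + sqrt 2 e f, and rho (x) tau of a generator X sends this
   to Gamma_w2 (E (- rho(X) f)). Stability of the image and uniqueness of the
   action follow for all X because osp(1|2n) is generated by the X_{+-j}. *)

From HB Require Import structures.
Require Import Defs.

Set Implicit Arguments.
Unset Strict Implicit.
Unset Printing Implicit Defensive.

Import GRing.Theory Num.Theory.
Local Open Scope ring_scope.

(** The parity of the matrix unit in position (i, j), true standing for odd. *)
Local Notation par2 i j := (ixpar i (+) ixpar j).

(** * Basis indices of the superspace of dimension 1|2n *)

Section Indices.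
Variable n : nat.
Implicit Types (i : 'I_(1 + (n + n))) (j k : 'I_n).

Lemma ix_ind (P : 'I_(1 + (n + n)) -> Prop) :
  P ix0 -> (forall j, P (ixl j)) -> (forall j, P (ixr j)) -> forall i, P i.
Proof.
move=> P0 Pl Pr i; case: (split_ordP i) => [a ->|a ->]; first by rewrite (ord1 a).
by case: (split_ordP a) => [b ->|b ->]; [apply: Pl|apply: Pr].
Qed.

Lemma ixlE j k : (ixl j == ixl k) = (j == k).
Proof. by rewrite /ixl eq_rshift eq_lshift. Qed.

Lemma ixrE j k : (ixr j == ixr k) = (j == k).
Proof. by rewrite /ixr !eq_rshift. Qed.

Lemma ixlrE j k : (ixl j == ixr k) = false.
Proof. by rewrite /ixl /ixr eq_rshift eq_lrshift. Qed.

Lemma ixrlE j k : (ixr j == ixl k) = false.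
Proof. by rewrite eq_sym ixlrE. Qed.

Lemma ixl0E j : (ixl j == ix0) = false.
Proof. by rewrite /ixl /ix0 eq_rlshift. Qed.

Lemma ixr0E j : (ixr j == ix0) = false.
Proof. by rewrite /ixr /ix0 eq_rlshift. Qed.

Lemma ix0lE j : (ix0 == ixl j) = false.
Proof. by rewrite eq_sym ixl0E. Qed.

Lemma ix0rE j : (ix0 == ixr j) = false.
Proof. by rewrite eq_sym ixr0E. Qed.

Definition ixE := (ixlE, ixrE, ixlrE, ixrlE, ixl0E, ixr0E, ix0lE, ix0rE, eqxx).

Lemma ixpar_lshift (a : 'I_1) : ixpar (lshift (n + n) a) = false.
Proof. by rewrite /ixpar (ord1 a) eqxx. Qed.

Lemma ixpar_rshift (a : 'I_(n + n)) : ixpar (rshift 1 a) = true.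
Proof. by rewrite /ixpar eq_rlshift. Qed.

End Indices.

(** * Matrix structure of osp(1|2n) and its generation by odd root vectors *)

Section Generators.
Variables (C : numClosedFieldType) (n : nat).
Local Notation gl := 'M[C]_(1 + (n + n)).
Local Notation J := (symplJ C n).
Implicit Types (X Y : gl) (r : 'rV[C]_(n + n)) (A S : 'M[C]_(n + n)).

Lemma tr_symplJ : J^T = - J.
Proof.
by rewrite /symplJ tr_block_mx opp_block_mx !linearN /= !trmx0 !trmx1 opprK oppr0.
Qed.

Lemma mul_symplJJ : J *m J = - 1%:M.
Proof.
rewrite /symplJ mulmx_block !mul0mx !mulmx0 !mul1mx mulmx1 !addr0 !add0r.
by rewrite [in RHS]scalar_mx_block opp_block_mx oppr0.
Qed.

Lemma mul_symplJ_tr r : J *m r^T = (row_mx (rsubmx r) (- lsubmx r))^T.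
Proof.
rewrite -{1}(hsubmxK r) !tr_row_mx /symplJ mul_block_col !mul0mx !mul1mx mulNmx mul1mx.
by rewrite addr0 add0r linearN.
Qed.

Lemma is_sp_mulJ S : S^T = S -> is_sp (J *m S).
Proof.
move=> symS; rewrite /is_sp trmx_mul symS tr_symplJ mulmxA mul_symplJJ.
by rewrite -mulmxA mulNmx mul_symplJJ opprK mulmx1 mulNmx mul1mx subrr.
Qed.

(** Since J^T = - J, the condition defining sp(2n) says that J A is symmetric, and J J = - 1 gives A
    = J (- J A). Thus sp(2n) is J times the symmetric matrices. *)
Lemma is_spP A : is_sp A -> exists2 S, S^T = S & A = J *m S.
Proof.
move=> spA; exists (- (J *m A)).
  rewrite linearN /= trmx_mul tr_symplJ mulmxN opprK.
  by apply/eqP; rewrite -addr_eq0; apply/eqP.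
by rewrite mulmxN mulmxA mul_symplJJ mulNmx mul1mx opprK.
Qed.

(** The lower left column is J r^T, so block products reduce to the algebra of J. *)
Lemma osp_mxE r A : osp_mx r A = block_mx 0 r (J *m r^T) A.
Proof. by rewrite mul_symplJ_tr. Qed.

Lemma osp_mx_linear (a : C) r r' A A' :
  osp_mx (a *: r + r') (a *: A + A') = a *: osp_mx r A + osp_mx r' A'.
Proof.
rewrite !osp_mxE scale_block_mx add_block_mx scaler0 addr0.
by rewrite !linearD !linearZ /=.
Qed.

Lemma is_sp_linear (a : C) A A' : is_sp A -> is_sp A' -> is_sp (a *: A + A').
Proof.
rewrite /is_sp => spA spA'.
rewrite !linearD !linearZ /= mulmxDl -scalemxAl.
by rewrite addrACA -scalerDr spA spA' scaler0 addr0.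
Qed.

Lemma is_osp_linear (a : C) X Y : is_osp X -> is_osp Y -> is_osp (a *: X + Y).
Proof.
move=> [r [A [spA ->]]] [r' [A' [spA' ->]]].
exists (a *: r + r'), (a *: A + A'); split; first exact: is_sp_linear.
by rewrite osp_mx_linear.
Qed.

Lemma is_sp0 : is_sp (0 : 'M[C]_(n + n)).
Proof. by rewrite /is_sp trmx0 mul0mx mulmx0 addr0. Qed.

Lemma is_osp0 : is_osp (0 : gl).
Proof.
exists 0, 0; split; first exact: is_sp0.
by rewrite osp_mxE trmx0 mulmx0 block_mx0.
Qed.

Definition osp_odd r : gl := osp_mx r 0.

Lemma is_osp_odd r : is_osp (osp_odd r).
Proof. by exists r, 0; split=> //; apply: is_sp0. Qed.

Lemma gl_homog_odd r : gl_homog true (osp_odd r).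
Proof.
by rewrite /gl_homog /gl_odd /osp_odd /osp_mx block_mxKur block_mxKdl.
Qed.

Lemma sbracket_odd r r' :
  sbracket true true (osp_odd r) (osp_odd r') = osp_mx 0 (J *m (r^T *m r' + r'^T *m r)).
Proof.
rewrite /sbracket /osp_odd !osp_mxE expr1 scaleN1r opprK !mulmx_block.
rewrite !mul0mx !mulmx0 !addr0 !add0r add_block_mx addr0 trmx0 mulmx0.
rewrite mulmxDr !mulmxA; congr block_mx; last by rewrite addr0.
(* The even corner r J r'^T + r' J r^T is a 1 x 1 matrix, hence equal to its transpose; antisymmetry
   of J makes the two summands opposite. *)
apply/eqP; rewrite addrC addr_eq0 -[_ *m _ *m _]trmxK.
rewrite [X in X^T]mx11_scalar tr_scalar_mx -mx11_scalar !trmx_mul trmxK tr_symplJ.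
by rewrite mulNmx mulmxN mulmxA.
Qed.

Lemma is_osp_sbracket_odd r r' :
  is_osp (sbracket true true (osp_odd r) (osp_odd r')).
Proof.
exists 0, (J *m (r^T *m r' + r'^T *m r)); split; last exact: sbracket_odd.
by apply: is_sp_mulJ; rewrite linearD /= !trmx_mul !trmxK addrC.
Qed.

Lemma Xpos_odd (j : 'I_n) : Xpos j = osp_odd (delta_mx 0 (rshift n j)).
Proof.
rewrite /osp_odd /osp_mx; apply/matrixP=> a b; rewrite [LHS]mxE.
elim/ix_ind: a => [|a|a]; elim/ix_ind: b => [|b|b];
  rewrite ?block_mxEul ?block_mxEur ?block_mxEdl ?block_mxEdr.
all: rewrite !mxE ?ixE ?(unsplitK (inl _)) ?(unsplitK (inr _)) ?mxE ?eqxx /= ?eq_rshift ?eq_lrshift ?eq_rlshift.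
all: by rewrite ?andbF ?andbT ?oppr0 ?addr0 ?add0r // eq_sym.
Qed.

Lemma Xneg_odd (j : 'I_n) : Xneg j = osp_odd (delta_mx 0 (lshift n j)).
Proof.
rewrite /osp_odd /osp_mx; apply/matrixP=> a b; rewrite [LHS]mxE.
elim/ix_ind: a => [|a|a]; elim/ix_ind: b => [|b|b];
  rewrite ?block_mxEul ?block_mxEur ?block_mxEdl ?block_mxEdr.
all: rewrite !mxE ?ixE ?(unsplitK (inl _)) ?(unsplitK (inr _)) ?mxE ?eqxx /= ?eq_lshift ?eq_lrshift ?eq_rlshift.
all: by rewrite ?andbF ?andbT ?oppr0 ?addr0 ?add0r // eq_sym.
Qed.

(* A = J S with S symmetric, and J (e_a^T e_b + e_b^T e_a) is the bracket of two
   odd generators. *)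
Lemma osp_ind (P : gl -> Prop) :
  P 0 -> (forall (a : C) X Y, P X -> P Y -> P (a *: X + Y)) ->
  (forall j, P (Xpos j)) -> (forall j, P (Xneg j)) ->
  (forall r r', P (osp_odd r) -> P (osp_odd r') ->
     P (sbracket true true (osp_odd r) (osp_odd r'))) ->
  forall X, is_osp X -> P X.
Proof.
move=> P0 Plin Ppos Pneg Pbr X [r [A [/is_spP [S symS ->] ->]]].
have lincomb (V : lmodType C) (Q : V -> Prop) (I : finType) (a : I -> C) (F : I -> V) :
    Q 0 -> (forall c u v, Q u -> Q v -> Q (c *: u + v)) -> (forall i, Q (F i)) ->
    Q (\sum_i a i *: F i).
  by move=> Q0 Qlin QF; elim/big_rec: _ => // i Y _ QY; apply: Qlin.
have osp0 : osp_mx 0 0 = 0 :> gl by rewrite osp_mxE trmx0 mulmx0 block_mx0.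
(* Odd elements are linear combinations of the [Xpos j] and [Xneg j], which correspond to the unit
   rows. *)
have Podd r' : P (osp_odd r').
  rewrite (row_sum_delta r'); apply: (lincomb _ (P \o osp_odd)) => /= [|c u v Pu Pv|a].
  - by rewrite /osp_odd osp0.
  - have := Plin c _ _ Pu Pv; rewrite /osp_odd -osp_mx_linear.
    by rewrite scaler0 addr0.
  - by case: (split_ordP a) => [j ->|j ->]; rewrite -?Xpos_odd -?Xneg_odd.
pose Q S' := P (osp_mx 0 (J *m S')).
have Q0 : Q 0 by rewrite /Q mulmx0 osp0.
have Qlin c S1 S2 : Q S1 -> Q S2 -> Q (c *: S1 + S2).
  move=> Q1 Q2; have := Plin c _ _ Q1 Q2; rewrite /Q -osp_mx_linear.
  by rewrite scaler0 addr0 linearD linearZ.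
have QS : Q S.
  (* The symmetrization S = 1/2 (S + S^T), expanded in matrix units so that each term comes from a
     bracket of odd elements. *)
  have -> : S = \sum_a 2%:R^-1 *: \sum_b S a b *:
      ((delta_mx 0 a : 'rV_(n + n))^T *m delta_mx 0 b +
       (delta_mx 0 b : 'rV_(n + n))^T *m delta_mx 0 a).
    rewrite -scaler_sumr; apply: (@scalerI _ _ 2%:R); first by rewrite pnatr_eq0.
    rewrite scalerA divff ?pnatr_eq0 // scale1r scaler_nat mulr2n.
    under eq_bigr => a _ do under eq_bigr => b _ do
      rewrite !trmx_delta !mul_delta_mx scalerDr.
    under eq_bigr => a _ do rewrite big_split /=.
    rewrite big_split /= -matrix_sum_delta; congr (_ + _).
    rewrite exchange_big /= {1}[S]matrix_sum_delta; apply: eq_bigr => a _.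
    by apply: eq_bigr => b _; rewrite -{1}symS mxE.
  apply: (lincomb _ Q) => // a; apply: (lincomb _ Q) => // b.
  by rewrite /Q -sbracket_odd; apply: Pbr.
have := Plin 1 _ _ (Podd r) QS.
by rewrite -osp_mx_linear !scale1r addr0 add0r.
Qed.
End Generators.

(** * The parity involution of the polynomial algebra *)

Section PolySign.
Variables (C : numClosedFieldType) (n : nat).
Local Notation poly := {mpoly C[n]}.
Implicit Types (f g : poly) (p q b : bool).

Lemma mcoeff_poly_sign f m : (poly_sign f)@_m = (-1) ^+ mdeg m * f@_m.
Proof.
rewrite /poly_sign raddf_sum /=.
under eq_bigr => k _ do rewrite mcoeffZ mcoeffX.
have [mf|mf] := boolP (m \in msupp f).
  rewrite (bigD1_seq m) ?msupp_uniq //= eqxx mulr1 big1 ?addr0 // => k /negbTE ->.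
  by rewrite mulr0.
rewrite (memN_msupp_eq0 mf) mulr0 big_seq big1 // => k kf.
by case: eqP => [km|_]; [rewrite -km kf in mf | rewrite mulr0].
Qed.

Lemma poly_sign_is_linear : linear (@poly_sign C n).
Proof.
move=> a f g; apply/mpolyP=> m.
by rewrite mcoeffD mcoeffZ !mcoeff_poly_sign mcoeffD mcoeffZ mulrDr mulrCA.
Qed.

HB.instance Definition _ :=
  GRing.isLinear.Build C poly poly _ (@poly_sign C n) poly_sign_is_linear.

Lemma poly_signK : involutive (@poly_sign C n).
Proof.
move=> f; apply/mpolyP=> m.
by rewrite !mcoeff_poly_sign mulrA -expr2 sqrr_sign mul1r.
Qed.

(** Differentiation shifts the degree by one, which flips the sign; the same holds for
    multiplication by a variable below. *)
Lemma poly_sign_deriv (i : 'I_n) f : poly_sign f^`M(i) = - (poly_sign f)^`M(i).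
Proof.
apply/mpolyP=> m; rewrite mcoeffN !(mcoeff_deriv, mcoeff_poly_sign) mdegD mdeg1.
by rewrite addn1 exprS mulN1r mulNr mulNrn opprK mulrnAr.
Qed.

Lemma poly_signX m : poly_sign 'X_[m] = (-1) ^+ mdeg m *: 'X_[m] :> poly.
Proof. by rewrite /poly_sign msuppX big_seq1 mcoeffX eqxx mulr1. Qed.

Lemma poly_signMX (i : 'I_n) f : poly_sign ('X_i * f) = - ('X_i * poly_sign f).
Proof.
elim/mpolyind: f => [|c m f _ _ IH]; first by rewrite mulr0 linear0 mulr0 oppr0.
rewrite mulrDr -scalerAr -mpolyXD !linearD !linearZ /= IH !poly_signX mdegD mdeg1.
rewrite add1n exprS mulN1r mulrDr opprD -!scalerAr -mpolyXD.
by rewrite scaleNr scalerN.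
Qed.

(** Homogeneity becomes an eigenvalue equation, so that parity statements can be proved by
    rewriting. For the converse, a nonzero coefficient can be cancelled, and the sign determines
    p. *)
Lemma poly_homogP p f : poly_homog p f <-> poly_sign f = (-1) ^+ p *: f.
Proof.
split=> [hf|hf m].
  apply/mpolyP=> m; rewrite mcoeff_poly_sign mcoeffZ.
  have [/hf <-|/memN_msupp_eq0 ->] := boolP (m \in msupp f); last by rewrite !mulr0.
  by rewrite signr_odd.
rewrite mcoeff_msupp => fm.
move/mpolyP/(_ m): hf; rewrite mcoeff_poly_sign mcoeffZ -signr_odd => /(mulIf fm).
exact: signr_inj.
Qed.

(** The b-th power of the involution: the sign rule for an operator of parity b moving past a
    polynomial. *)
Definition psign b f : poly := if b then poly_sign f else f.

Arguments psign : simpl never.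

Lemma psign_is_linear b : linear (psign b).
Proof. by case: b => // a f g; rewrite /psign linearP. Qed.

HB.instance Definition _ b :=
  GRing.isLinear.Build C poly poly _ (psign b) (psign_is_linear b).

Lemma psignD p q f : psign p (psign q f) = psign (p (+) q) f.
Proof. by case: p q => [] [] //=; rewrite /psign poly_signK. Qed.

Lemma psign_homog b p f : poly_homog p f -> psign b f = (-1) ^+ (b && p) *: f.
Proof. by move/poly_homogP; rewrite /psign; case: b => //= _; rewrite scale1r. Qed.

End PolySign.

(** * Coordinates and parity in the tensor product *)

Section TensorRepresentation.
Variables (C : numClosedFieldType) (n : nat).
Local Notation gl := 'M[C]_(1 + (n + n)).
Local Notation poly := {mpoly C[n]}.
Local Notation T := (tensor C n).
Implicit Types (X Y : gl) (f g : poly) (u v : T) (p q b : bool).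

Lemma gl_evenE X i j : gl_even X i j = if par2 i j then 0 else X i j.
Proof.
rewrite /gl_even -{3}[X]submxK.
case: (split_ordP i) => a ->; case: (split_ordP j) => b ->;
by rewrite ?block_mxEul ?block_mxEur ?block_mxEdl ?block_mxEdr
  ?ixpar_lshift ?ixpar_rshift ?mxE.
Qed.

Lemma gl_oddE X i j : gl_odd X i j = if par2 i j then X i j else 0.
Proof.
rewrite /gl_odd -{3}[X]submxK.
case: (split_ordP i) => a ->; case: (split_ordP j) => b ->;
by rewrite ?block_mxEul ?block_mxEur ?block_mxEdl ?block_mxEdr
  ?ixpar_lshift ?ixpar_rshift ?mxE.
Qed.

Lemma gl_homogP p X i j : gl_homog p X -> par2 i j != p -> X i j = 0.
Proof.
by rewrite /gl_homog => ->; case: p; rewrite ?gl_evenE ?gl_oddE; case: (par2 i j).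
Qed.

(** The even and odd parts of X merge into one sum, because the entry (i, j) belongs to exactly one
    of them, according to [par2 i j]. *)
Lemma tens_repE rho X u i :
  tens_rep rho X u i = rho X (u i) + \sum_j X i j *: psign (par2 i j) (u j).
Proof.
rewrite /tens_rep !ffunE -addrA; congr (_ + _).
  rewrite (bigD1 i) //= mxE eqxx scale1r big1 ?addr0 // => j ji.
  by rewrite mxE eq_sym (negbTE ji) scale0r.
rewrite -big_split /=; apply: eq_bigr => j _.
by rewrite gl_evenE gl_oddE; case: (par2 i j); rewrite scale0r ?add0r ?addr0.
Qed.

(** The parity involution of the tensor product: the sign of the polynomial factor times that of the
    basis vector. *)
Definition tsign u : T := [ffun i => poly_sign ((-1) ^+ ixpar i *: u i)].

Lemma tsign_is_linear : linear tsign.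
Proof.
move=> a u v; apply/ffunP=> i; rewrite !ffunE -linearP /=.
by rewrite scalerDr !scalerA mulrC.
Qed.

HB.instance Definition _ := GRing.isLinear.Build C T T _ tsign tsign_is_linear.

Lemma tensor_homogP p u : tensor_homog p u <-> tsign u = (-1) ^+ p *: u.
Proof.
split=> [hu|hu i].
  apply/ffunP=> i; rewrite !ffunE linearZ /=.
  have /poly_homogP -> := hu i; rewrite scalerA signr_addb.
  by rewrite mulrCA -expr2 sqrr_sign mulr1.
move/ffunP/(_ i): hu; rewrite !ffunE linearZ /= => hu; apply/poly_homogP.
by rewrite signr_addb mulrC -scalerA -hu scalerA -expr2 sqrr_sign scale1r.
Qed.

End TensorRepresentation.

(** * Linearity of a representation on the whole space *)

Section Representations.
Variables (C : numClosedFieldType) (n : nat) (V : lmodType C).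
Variables (par : bool -> V -> Prop).
Local Notation gl := 'M[C]_(1 + (n + n)).
Variables (act : gl -> V -> V) (actP : osp_rep par (fun=> True) act).

Lemma osp_repD X : is_osp X -> {morph act X : u v / u + v}.
Proof.
by move=> oX u v; have := osp_rep_linearr actP 1 (u := u) (v := v) oX I I; rewrite !scale1r.
Qed.

Lemma osp_rep0 X : is_osp X -> act X 0 = 0.
Proof.
move=> oX; apply: (addIr (act X 0)).
by rewrite -osp_repD // addr0 add0r.
Qed.

Lemma osp_repZ X a : is_osp X -> {morph act X : u / a *: u}.
Proof.
move=> oX u; have := osp_rep_linearr actP a (u := u) (v := 0) oX I I.
by rewrite osp_rep0 // !addr0.
Qed.

Lemma osp_rep_lincomb X (I : finType) (a : I -> C) (F : I -> V) : is_osp X ->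
  act X (\sum_i a i *: F i) = \sum_i a i *: act X (F i).
Proof.
move=> oX; rewrite (big_morph _ (osp_repD oX) (osp_rep0 oX)).
by apply: eq_bigr => i _; rewrite osp_repZ.
Qed.

End Representations.

(** * Closure properties of homogeneous polynomials *)

Section PolyHomog.
Variables (C : numClosedFieldType) (n : nat).
Implicit Types f g : {mpoly C[n]}.

Lemma poly_homog0 p : poly_homog p (0 : {mpoly C[n]}).
Proof. by apply/poly_homogP; rewrite linear0 scaler0. Qed.

Lemma poly_homog_linear p a f g :
  poly_homog p f -> poly_homog p g -> poly_homog p (a *: f + g).
Proof.
move=> /poly_homogP hf /poly_homogP hg; apply/poly_homogP.
by rewrite linearP /= hf hg scalerDr !scalerA mulrC.
Qed.

Lemma poly_homogD p f g : poly_homog p f -> poly_homog p g -> poly_homog p (f + g).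
Proof. by move=> hf hg; rewrite -[f]scale1r; apply: poly_homog_linear. Qed.

Lemma poly_homog_lincomb p (I : finType) (a : I -> C) (F : I -> {mpoly C[n]}) :
  (forall i, a i != 0 -> poly_homog p (F i)) -> poly_homog p (\sum_i a i *: F i).
Proof.
move=> hF; elim/big_rec: _ => [|i g _ hg]; first exact: poly_homog0.
have [->|/hF hi] := eqVneq (a i) 0; first by rewrite scale0r add0r.
exact: poly_homog_linear.
Qed.

Lemma poly_homog_psign b p f : poly_homog p f -> poly_homog p (psign b f).
Proof.
move=> hf; rewrite (psign_homog _ hf) -[_ *: f]addr0.
by apply: poly_homog_linear => //; apply: poly_homog0.
Qed.

End PolyHomog.

Lemma osp_rep_at0 (C : numClosedFieldType) (n : nat) (V : lmodType C)
    (par : bool -> V -> Prop) (W : V -> Prop) (act : 'M[C]_(1 + (n + n)) -> V -> V) u :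
  osp_rep par W act -> W u -> act 0 u = 0.
Proof.
move=> actP Wu; have := osp_rep_linearl actP 1 (is_osp0 _ _) (is_osp0 _ _) Wu.
rewrite scaler0 addr0 scale1r => /eqP.
by rewrite -subr_eq0 opprD addNKr oppr_eq0 => /eqP.
Qed.

(** * Conjugation, restriction and uniqueness of representations *)

Section Transfer.
Variables (C : numClosedFieldType) (n : nat) (V : lmodType C).
Variables (par : bool -> V -> Prop).
Local Notation gl := 'M[C]_(1 + (n + n)).
Variables (act : gl -> V -> V) (actP : osp_rep par (fun=> True) act).

Lemma osp_rep_conj (G Gi : {linear V -> V}) :
  cancel Gi G ->
  (forall p u, par p u -> par p (G u)) -> (forall p u, par p u -> par p (Gi u)) ->
  osp_rep par (fun=> True) (fun X u => Gi (act X (G u))).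
Proof.
move=> GiK parG parGi; split=> //.
- by move=> a X Y u oX oY _; rewrite (osp_rep_linearl actP) // linearP.
- by move=> a X u v oX _ _; rewrite linearP (osp_rep_linearr actP) // linearP.
- move=> p q X u oX hX _ hu; apply/parGi/(osp_rep_parity actP) => //; exact: parG.
- move=> p q X Y u oX oY hX hY _.
  by rewrite !GiK (osp_rep_bracket actP) // linearB linearZ.
Qed.

(** The identities restrict from V to W, so only stability is at stake. The elements preserving W
    are closed under linear combinations and odd brackets, hence the generators suffice. *)
Lemma osp_rep_sub (W : V -> Prop) :
  W 0 -> (forall a u v, W u -> W v -> W (a *: u + v)) ->
  (forall j u, W u -> W (act (Xpos j) u)) -> (forall j u, W u -> W (act (Xneg j) u)) ->
  osp_rep par W act.
Proof.
move=> W0 Wlin Wpos Wneg; case: (actP) => _ linl linr hpar hbr.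
split; [|by move=> *; auto..].
(* Membership in osp is carried through the induction because the axioms of [osp_rep] apply only to
   elements of osp. *)
move=> X u oX; suff [_] : is_osp X /\ forall u, W u -> W (act X u) by apply.
elim/osp_ind: {u} X / oX => [|a X Y [oX IX] [oY IY]|j|j|r r' [_ IX] [_ IY]].
- split=> [|u _]; first exact: is_osp0.
  by rewrite (osp_rep_at0 actP).
- split=> [|u Wu]; first exact: is_osp_linear.
  by rewrite linl //; apply: Wlin; auto.
- by split; [rewrite Xpos_odd; apply: is_osp_odd | auto].
- by split; [rewrite Xneg_odd; apply: is_osp_odd | auto].
- split=> [|u Wu]; first exact: is_osp_sbracket_odd.
  rewrite (hbr true true) //; try exact: is_osp_odd; try exact: gl_homog_odd.
  by rewrite addrC -scaleNr; apply: Wlin; auto.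
Qed.

End Transfer.

(** The elements on which two representations agree are closed under linear combinations and odd
    brackets, so agreement on generators propagates. *)
Lemma osp_rep_unique (C : numClosedFieldType) (n : nat) (V : lmodType C)
    (par : bool -> V -> Prop) (W : V -> Prop)
    (act act' : 'M[C]_(1 + (n + n)) -> V -> V) :
  W 0 -> osp_rep par W act -> osp_rep par W act' ->
  (forall j u, W u -> act (Xpos j) u = act' (Xpos j) u) ->
  (forall j u, W u -> act (Xneg j) u = act' (Xneg j) u) ->
  forall X u, is_osp X -> W u -> act X u = act' X u.
Proof.
move=> W0 aP a'P epos eneg X u oX.
suff [_] : is_osp X /\ forall u, W u -> act X u = act' X u by apply.
elim/osp_ind: {u} X / oX => [|a X Y [oX IX] [oY IY]|j|j|r r' [oX IX] [oY IY]].
- split=> [|u Wu]; first exact: is_osp0.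
  by rewrite (osp_rep_at0 aP) // (osp_rep_at0 a'P).
- split=> [|u Wu]; first exact: is_osp_linear.
  by rewrite (osp_rep_linearl aP) // (osp_rep_linearl a'P) // IX // IY.
- by split; [rewrite Xpos_odd; apply: is_osp_odd | auto].
- by split; [rewrite Xneg_odd; apply: is_osp_odd | auto].
- split=> [|u Wu]; first exact: is_osp_sbracket_odd.
  have hX := gl_homog_odd r; have hY := gl_homog_odd r'.
  rewrite (osp_rep_bracket aP oX oY hX hY Wu) (osp_rep_bracket a'P oX oY hX hY Wu).
  rewrite [act _ u]IY // [act (osp_odd r) u]IX //.
  (* The inner vector has become the image under [act'] of a vector of W, so it lies in W and the
     outer actions agree on it as well. *)
  rewrite IX; last by apply: (osp_rep_stable a'P).
  by rewrite IY //; apply: (osp_rep_stable a'P).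
Qed.

(** * The tensor product is a representation *)

Section TensorRep.
Variables (C : numClosedFieldType) (n : nat).
Local Notation gl := 'M[C]_(1 + (n + n)).
Local Notation poly := {mpoly C[n]}.
Local Notation T := (tensor C n).
Variables (rho : gl -> poly -> poly) (rhoP : osp_rep poly_homog (fun=> True) rho).
Implicit Types (X Y : gl) (f g : poly) (u v : T) (p q b : bool).

Lemma tensor_linE a u v i : (a *: u + v) i = a *: u i + v i.
Proof. by rewrite !ffunE. Qed.

(** An operator of parity p commutes with the involution s up to (-1)^p. The parity axiom yields
    this on homogeneous polynomials, and f is half the sum of f + s f and f - s f. *)
Lemma osp_rep_psign p X b f : is_osp X -> gl_homog p X ->
  rho X (psign b f) = (-1) ^+ (p && b) *: psign b (rho X f).
Proof.
move=> oX hX; case: b; rewrite ?andbF ?andbT ?scale1r // /psign.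
(* The argument of rho(X) is twice the component of f of parity b. *)
have hs b : poly_sign (rho X (f + (-1) ^+ b *: poly_sign f)) =
            (-1) ^+ (p (+) b) *: rho X (f + (-1) ^+ b *: poly_sign f).
  apply/poly_homogP/(osp_rep_parity rhoP) => //; apply/poly_homogP.
  rewrite linearD linearZ /= poly_signK scalerDr scalerA -expr2 sqrr_sign scale1r.
  by rewrite addrC.
have := hs true; have := hs false.
rewrite !(osp_repD rhoP oX, osp_repZ rhoP _ oX) !linearD !linearZ /=.
rewrite !(addbF, addbT, expr0, expr1, scale1r, scaleN1r) signrN scaleNr => e0 e1.
apply: (can_inj (scalerK (_ : (2 : C) != 0))); first by rewrite pnatr_eq0.
rewrite scalerA mulrC -scalerA.
have -> : 2 *: poly_sign (rho X f) = poly_sign (rho X f) + poly_sign (rho X (poly_sign f))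
  + (poly_sign (rho X f) - poly_sign (rho X (poly_sign f))).
  by rewrite addrACA subrr addr0 scaler_nat mulr2n.
rewrite e0 e1 scaleNr opprK addrACA subrr add0r -scalerDr scalerA -expr2 sqrr_sign.
by rewrite scale1r scaler_nat mulr2n.
Qed.

(** A nonzero entry of Y has [par2 i j] equal to q, so the sign from commuting rho(X) past [psign]
    is the same for all entries. *)
Lemma scale_psign p q X Y i j f : is_osp X -> gl_homog p X -> gl_homog q Y ->
  Y i j *: rho X (psign (par2 i j) f) =
  (-1) ^+ (p && q) *: (Y i j *: psign (par2 i j) (rho X f)).
Proof.
move=> oX hX hY; rewrite (osp_rep_psign _ _ oX hX).
have [<-|/(gl_homogP hY) ->] := eqVneq (par2 i j) q; last by rewrite !scale0r scaler0.
by rewrite !scalerA mulrC.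
Qed.

(** The composite is split into its pure terms, from rho(X) rho(Y) and from the matrix product X Y,
    followed by the two mixed terms, which must cancel in the supercommutator. *)
Lemma tens_rep_comp X Y u i : is_osp X ->
  tens_rep rho X (tens_rep rho Y u) i =
  rho X (rho Y (u i)) + \sum_j (X *m Y) i j *: psign (par2 i j) (u j) +
  (\sum_j X i j *: psign (par2 i j) (rho Y (u j)) +
   \sum_j Y i j *: rho X (psign (par2 i j) (u j))).
Proof.
move=> oX; have -> : tens_rep rho X (tens_rep rho Y u) i =
    rho X (rho Y (u i)) + \sum_j Y i j *: rho X (psign (par2 i j) (u j)) +
    (\sum_j X i j *: psign (par2 i j) (rho Y (u j)) +
     \sum_j (X *m Y) i j *: psign (par2 i j) (u j)).
  rewrite tens_repE tens_repE (osp_repD rhoP) // (osp_rep_lincomb rhoP) //.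
  congr (_ + _); under eq_bigr => j _ do rewrite tens_repE linearD scalerDr /=.
  rewrite big_split /=; congr (_ + _).
  under [RHS]eq_bigr => j _ do rewrite mxE scaler_suml.
  rewrite [RHS]exchange_big /=; apply: eq_bigr => j _.
  rewrite linear_sum scaler_sumr; apply: eq_bigr => k _.
  by rewrite linearZ /= scalerA psignD addbA addbK.
rewrite -!addrA; congr (_ + _); rewrite addrC -addrA [RHS]addrCA; congr (_ + _).
Qed.

Lemma tens_rep_osp : osp_rep tensor_homog (fun=> True) (tens_rep rho).
Proof.
split=> //.
- move=> a X Y u oX oY _; apply/ffunP=> i; rewrite tensor_linE !tens_repE.
  rewrite (osp_rep_linearl rhoP) // scalerDr addrACA; congr (_ + _).
  rewrite scaler_sumr -big_split /=; apply: eq_bigr => j _.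
  by rewrite !mxE scalerDl scalerA.
- move=> a X u v oX _ _; apply/ffunP=> i; rewrite tensor_linE !tens_repE.
  rewrite tensor_linE (osp_rep_linearr rhoP) // scalerDr addrACA; congr (_ + _).
  rewrite scaler_sumr -big_split /=; apply: eq_bigr => j _.
  by rewrite tensor_linE linearP scalerDr !scalerA mulrC.
- move=> p q X u oX hX _ hu i; rewrite tens_repE; apply: poly_homogD.
    by rewrite -addbA; apply: (osp_rep_parity rhoP).
  apply: poly_homog_lincomb => j Xij; apply: poly_homog_psign.
  (* A nonzero entry of X forces [par2 i j] to be p, which matches the parities of source and target
     coordinates. *)
  have <- : q (+) ixpar j = p (+) q (+) ixpar i by
    have [<-|/(gl_homogP hX) e] := eqVneq (par2 i j) p;
    [case: (ixpar i) (ixpar j) (q) => [] [] [] | rewrite e eqxx in Xij].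
  exact: hu.
- move=> p q X Y u oX oY hX hY _; apply/ffunP=> i.
  rewrite addrC -scaleNr tensor_linE addrC scaleNr !tens_rep_comp // tens_repE.
  rewrite (osp_rep_bracket rhoP oX oY hX hY) //.
  have -> : \sum_j sbracket p q X Y i j *: psign (par2 i j) (u j) =
      \sum_j (X *m Y) i j *: psign (par2 i j) (u j) -
      (-1) ^+ (p && q) *: \sum_j (Y *m X) i j *: psign (par2 i j) (u j).
    rewrite scaler_sumr -sumrB; apply: eq_bigr => j _.
    by rewrite [sbracket]lock !mxE -lock /sbracket !mxE scalerBl scalerA.
  (* The mixed terms of X after Y equal (-1)^(pq) times those of Y after X, so they drop out of the
     superbracket. *)
  have -> : \sum_j X i j *: psign (par2 i j) (rho Y (u j)) +
      \sum_j Y i j *: rho X (psign (par2 i j) (u j)) =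
      (-1) ^+ (p && q) *: (\sum_j Y i j *: psign (par2 i j) (rho X (u j)) +
        \sum_j X i j *: rho Y (psign (par2 i j) (u j))).
    rewrite addrC scalerDr !scaler_sumr; congr (_ + _); apply: eq_bigr => j _.
      exact: scale_psign.
    by rewrite (scale_psign _ _ _ oY hY hX) andbC scalerA -expr2 sqrr_sign scale1r.
  rewrite [X in _ = _ - X]scalerDr opprD [RHS]addrACA subrr addr0.
  by rewrite [in RHS]scalerDr opprD [RHS]addrACA.
Qed.
End TensorRep.

Lemma tensor_linD (C : numClosedFieldType) n (u v : tensor C n) i : (u + v) i = u i + v i.
Proof. by rewrite !ffunE. Qed.

(** * Inverse and parity of the intertwining operator *)

Section Gamma.
Variables (C : numClosedFieldType) (n : nat).
Local Notation gl := 'M[C]_(1 + (n + n)).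
Local Notation poly := {mpoly C[n]}.
Local Notation T := (tensor C n).
Local Notation r2 := (sqrtC (2 : C)).
Implicit Types (X Y : gl) (f g : poly) (u v : T) (p q b : bool).

Lemma sum_Xpos (V : lmodType C) k i (F : 'I_(1 + (n + n)) -> V) :
  \sum_j (Xpos k : gl) i j *: F j =
  (i == ixl k)%:R *: F ix0 + (i == ix0)%:R *: F (ixr k).
Proof.
under eq_bigr => j _ do rewrite !mxE scalerDl.
rewrite big_split /=; congr (_ + _).
  rewrite (bigD1 ix0) //= eqxx andbT big1 ?addr0 // => j /negbTE ->.
  by rewrite andbF scale0r.
rewrite (bigD1 (ixr k)) //= eqxx andbT big1 ?addr0 // => j /negbTE ->.
by rewrite andbF scale0r.
Qed.

Lemma sum_Xneg (V : lmodType C) k i (F : 'I_(1 + (n + n)) -> V) :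
  \sum_j (Xneg k : gl) i j *: F j =
  - (i == ixr k)%:R *: F ix0 + (i == ix0)%:R *: F (ixl k).
Proof.
under eq_bigr => j _ do rewrite !mxE scalerDl.
rewrite big_split /=; congr (_ + _).
  rewrite (bigD1 ix0) //= eqxx andbT big1 ?addr0 // => j /negbTE ->.
  by rewrite andbF oppr0 scale0r.
rewrite (bigD1 (ixl k)) //= eqxx andbT big1 ?addr0 // => j /negbTE ->.
by rewrite andbF scale0r.
Qed.

Definition vac f : T := tens f v0.

Lemma vacE f i : vac f i = (i == ix0)%:R *: f.
Proof. by rewrite /vac /tens ffunE mxE eqxx andbT. Qed.

Lemma vac_is_linear : linear vac.
Proof.
move=> a f g; apply/ffunP=> i; rewrite tensor_linE !vacE scalerDr.
by rewrite !scalerA mulrC.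
Qed.

HB.instance Definition _ := GRing.isLinear.Build C poly T _ vac vac_is_linear.

Lemma vacZ a f : vac (a *: f) = a *: vac f.
Proof. exact: linearZ. Qed.

(** The contribution of the v_0-columns of the T_{+-k}; the minus sign in T_{-k} v_0 = - v_{n+k}
    cancels the one in [Gamma_w2]. *)
Definition excite f : T :=
  [ffun i => \sum_k (i == ixl k)%:R *: (poly_sign f)^`M(k)
           + \sum_k (i == ixr k)%:R *: ('X_k * poly_sign f)].

Lemma excite0 f : excite f ix0 = 0.
Proof.
rewrite ffunE !big1 ?addr0 // => k _; by rewrite ixE scale0r.
Qed.

Lemma excite_l f k : excite f (ixl k) = (poly_sign f)^`M(k).
Proof.
rewrite ffunE [X in _ + X]big1 => [|j _]; last by rewrite ixE scale0r.
rewrite addr0 (bigD1 k) //= eqxx scale1r big1 ?addr0 // => j jk.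
by rewrite ixE eq_sym (negbTE jk) scale0r.
Qed.

Lemma excite_r f k : excite f (ixr k) = 'X_k * poly_sign f.
Proof.
rewrite ffunE big1 => [|j _]; last by rewrite ixE scale0r.
rewrite add0r (bigD1 k) //= eqxx scale1r big1 ?addr0 // => j jk.
by rewrite ixE eq_sym (negbTE jk) scale0r.
Qed.

Lemma tensorP u v : u ix0 = v ix0 -> (forall k, u (ixl k) = v (ixl k)) ->
  (forall k, u (ixr k) = v (ixr k)) -> u = v.
Proof. by move=> *; apply/ffunP; apply: ix_ind. Qed.

Lemma excite_is_linear : linear excite.
Proof.
move=> a f g; apply: tensorP => [|k|k]; rewrite tensor_linE.
- by rewrite !excite0 scaler0 addr0.
- by rewrite !excite_l !linearP.
- by rewrite !excite_r linearP mulrDr scalerAr.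
Qed.

HB.instance Definition _ := GRing.isLinear.Build C poly T _ excite excite_is_linear.

(** The contribution of the v_0-rows of the T_{+-k}, that is, of T_k v_{n+k} = v_0 and T_{-k} v_k =
    v_0. *)
Definition relax u : poly :=
  \sum_k (poly_sign (u (ixr k)))^`M(k) - \sum_k 'X_k * poly_sign (u (ixl k)).

Lemma relax_is_linear : linear relax.
Proof.
move=> a u v; rewrite /relax scalerBr addrACA -opprD !scaler_sumr -!big_split /=.
congr (_ - _); apply: eq_bigr => k _; rewrite tensor_linE !linearP //=.
by rewrite mulrDr scalerAr.
Qed.

HB.instance Definition _ := GRing.isLinear.Build C T poly _ relax relax_is_linear.

Lemma relax_vac f : relax (vac f) = 0.
Proof.
rewrite /relax !big1 ?subr0 // => k _.
  by rewrite vacE ixE scale0r linear0 mulr0.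
by rewrite vacE ixE scale0r !linear0.
Qed.

Lemma mderiv_XU (i j : 'I_n) : mderiv i ('X_j : poly) = (i == j)%:R.
Proof.
rewrite mderivX mnm1E eq_sym; case: eqP => [->|_]; last by rewrite scale0r.
rewrite scale1r (_ : (_ - _)%MM = 0%MM) ?mpolyX0 //.
by apply/mnmP=> k; rewrite mnmBE subnn mnm0E.
Qed.

(** Moving the involution through both factors turns the k-th term into x_k d_k f - d_k (x_k f) = -
    f, by the canonical commutation relation. *)
Lemma relax_excite f : relax (excite f) = - (n%:R *: f).
Proof.
have -> : n%:R *: f = \sum_(k < n) f by rewrite sumr_const card_ord scaler_nat.
rewrite /relax -sumrB -sumrN.
apply: eq_bigr => k _; rewrite excite_l excite_r poly_signMX poly_sign_deriv.
rewrite poly_signK linearN /= mderivM mderiv_XU eqxx mul1r mulrN opprK opprD.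
by rewrite addrNK.
Qed.

Lemma Gamma_w2E u : Gamma_w2 u = u + r2 *: (excite (u ix0) + vac (relax u)).
Proof.
rewrite /Gamma_w2 -addrA -scalerBr; congr (_ + _ *: _).
apply/ffunP=> i; rewrite [LHS]ffunE [X in _ + X]ffunE !sum_ffunE [RHS]ffunE vacE ffunE.
under eq_bigr => k _ do rewrite ffunE sum_Xpos.
under [X in _ - X]eq_bigr => k _ do rewrite ffunE sum_Xneg.
rewrite !big_split /= -!scaler_sumr opprD addrACA -scalerBr -sumrN; congr (_ + _ + _).
by apply: eq_bigr => k _; rewrite scaleNr opprK.
Qed.

Lemma Gamma_w2_is_linear : linear (@Gamma_w2 C n).
Proof.
move=> a u v; rewrite !Gamma_w2E tensor_linE !linearP /=.
rewrite [X in r2 *: X]addrACA -scalerDr [in RHS]scalerDr [RHS]addrACA.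
by congr (_ + _); rewrite [LHS]scalerDr !scalerA mulrC.
Qed.

HB.instance Definition _ :=
  GRing.isLinear.Build C T T _ (@Gamma_w2 C n) Gamma_w2_is_linear.

(** With w the image of u and a standing for [relax], w_0 = u_0 + sqrt 2 a u and a w = a u - sqrt 2
    n u_0. Eliminating a u gives w_0 - sqrt 2 a w = (1 + 2n) u_0. *)
Definition Gamma_inv0 u : poly := (1 + n.*2)%:R^-1 *: (u ix0 - r2 *: relax u).

(** Once the v_0-coordinate of the preimage is known, [excite] is subtracted from the odd
    coordinates, and the [vac] term resets the v_0-coordinate. *)
Definition Gamma_inv u : T :=
  u - r2 *: excite (Gamma_inv0 u) + vac (Gamma_inv0 u - u ix0).

Lemma sqrt2_neq0 : r2 != 0.
Proof. by rewrite sqrtC_eq0 pnatr_eq0. Qed.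

Lemma sqrt2_sqr : r2 * r2 = 2.
Proof. by rewrite -expr2 sqrtCK. Qed.

Lemma Gamma_w2_ix0 u : Gamma_w2 u ix0 = u ix0 + r2 *: relax u.
Proof.
rewrite Gamma_w2E addrC tensor_linE tensor_linD excite0 vacE eqxx scale1r add0r.
by rewrite addrC.
Qed.

Lemma relax_Gamma_w2 u : relax (Gamma_w2 u) = relax u - r2 *: (n%:R *: u ix0).
Proof.
rewrite Gamma_w2E addrC [relax _]linearP /= [relax (_ + _)]linearD /=.
by rewrite relax_excite relax_vac addr0 scalerN addrC.
Qed.

Lemma Gamma_inv0_Gamma u : Gamma_inv0 (Gamma_w2 u) = u ix0.
Proof.
rewrite /Gamma_inv0 Gamma_w2_ix0 relax_Gamma_w2 [r2 *: (relax _ - _)]scalerBr opprB addrA addrAC.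
rewrite addrK !scalerA sqrt2_sqr -natrM mul2n.
rewrite -[X in X + _]scale1r -scalerDl -(natrD C 1) scalerA mulVf ?scale1r ?pnatr_eq0 //.
Qed.

Lemma Gamma_w2K : cancel Gamma_w2 Gamma_inv.
Proof.
move=> u; rewrite /Gamma_inv Gamma_inv0_Gamma {1}Gamma_w2E scalerDr addrA.
have -> : u ix0 - Gamma_w2 u ix0 = - (r2 *: relax u).
  by rewrite Gamma_w2_ix0 opprD addrA subrr add0r.
by rewrite [vac (- _)]linearN /= [vac (_ *: _)]linearZ /= addrAC addrK addrK.
Qed.

Lemma Gamma_invK : cancel Gamma_inv Gamma_w2.
Proof.
move=> u; set f := Gamma_inv0 u.
have e0 : Gamma_inv u ix0 = f.
  rewrite /Gamma_inv -/f addrC -scaleNr [u + _]addrC tensor_linD tensor_linE.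
  by rewrite excite0 scaler0 add0r vacE eqxx scale1r subrK.
have er : relax (Gamma_inv u) = relax u + r2 *: (n%:R *: f).
  rewrite /Gamma_inv -/f [relax (_ + vac _)]linearD /= relax_vac addr0.
  rewrite [relax (_ - _)]linearB /= [relax (_ *: _)]linearZ /= relax_excite.
  by rewrite scalerN opprK.
rewrite Gamma_w2E e0 er scalerDr {1}/Gamma_inv -/f addrACA subrK -[r2 *: vac _]linearZ /=.
rewrite -[vac _ + vac _]linearD /=.
(* All that remains is the v_0-coordinate, which is the equation solved by [Gamma_inv0]. *)
suff -> : f - u ix0 + r2 *: (relax u + r2 *: (n%:R *: f)) = 0.
  by rewrite [vac 0]linear0 addr0.
have -> : u ix0 = (1 + n.*2)%:R *: f + r2 *: relax u.
  by rewrite /f /Gamma_inv0 scalerA divff ?scale1r ?subrK ?pnatr_eq0.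
move: {e0 er} f => f.
rewrite [r2 *: (relax _ + _)]scalerDr !scalerA sqrt2_sqr -natrM mul2n natrD scalerDl.
rewrite scale1r -(addrA f (_ *: _)) [in LHS]opprD [f + (_ + _)]addrA subrr add0r.
by rewrite [X in _ + X]addrC addNr.
Qed.

Lemma tsignE u i : tsign u i = poly_sign ((-1) ^+ ixpar i *: u i).
Proof. by rewrite ffunE. Qed.

Lemma tsign_ix0 u : tsign u ix0 = poly_sign (u ix0).
Proof. by rewrite tsignE /ixpar eqxx scale1r. Qed.

Lemma tsign_l u k : tsign u (ixl k) = - poly_sign (u (ixl k)).
Proof. by rewrite tsignE /ixpar ixE scaleN1r linearN. Qed.

Lemma tsign_r u k : tsign u (ixr k) = - poly_sign (u (ixr k)).
Proof. by rewrite tsignE /ixpar ixE scaleN1r linearN. Qed.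

Lemma tsign_vac f : tsign (vac f) = vac (poly_sign f).
Proof.
apply: tensorP => [|k|k]; rewrite ?(tsign_ix0, tsign_l, tsign_r) !vacE ixE.
- by rewrite !scale1r.
- by rewrite !scale0r linear0 oppr0.
- by rewrite !scale0r linear0 oppr0.
Qed.

Lemma tsign_excite f : tsign (excite f) = excite (poly_sign f).
Proof.
apply: tensorP => [|k|k].
- by rewrite tsign_ix0 !excite0 linear0.
- by rewrite tsign_l !excite_l poly_sign_deriv opprK.
- by rewrite tsign_r !excite_r poly_signMX opprK.
Qed.

Lemma relax_tsign u : relax (tsign u) = poly_sign (relax u).
Proof.
rewrite /relax [poly_sign (_ - _)]linearB /= !(linear_sum (@poly_sign C n)) /=.
congr (_ - _); apply: eq_bigr => k _.
  by rewrite tsign_r poly_sign_deriv !linearN.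
by rewrite tsign_l poly_signMX linearN mulrN.
Qed.

Lemma tsign_Gamma_w2 u : tsign (Gamma_w2 u) = Gamma_w2 (tsign u).
Proof.
rewrite !Gamma_w2E [tsign (_ + _)]linearD /= [tsign (_ *: _)]linearZ /=.
rewrite [tsign (_ + vac _)]linearD /= tsign_vac tsign_excite relax_tsign.
by rewrite tsign_ix0.
Qed.

Lemma tensor_homog_Gamma_w2 p u : tensor_homog p u -> tensor_homog p (Gamma_w2 u).
Proof.
move=> /tensor_homogP hu; apply/tensor_homogP.
by rewrite tsign_Gamma_w2 hu [LHS]linearZ.
Qed.

(** Evenness passes to the inverse: after applying the injective [Gamma_w2], the eigenvalue equation
    becomes that of u. *)
Lemma tensor_homog_Gamma_inv p u : tensor_homog p u -> tensor_homog p (Gamma_inv u).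
Proof.
move=> /tensor_homogP hu; apply/tensor_homogP; apply: (can_inj Gamma_w2K).
by rewrite -tsign_Gamma_w2 Gamma_invK hu linearZ /= Gamma_invK.
Qed.

Lemma Gamma_inv_is_linear : linear Gamma_inv.
Proof. exact: (can2_linear Gamma_w2K Gamma_invK). Qed.

HB.instance Definition _ :=
  GRing.isLinear.Build C T T _ Gamma_inv Gamma_inv_is_linear.

(** * Generators acting on the image of the vacuum line *)

Section Oscillator.
Variables (rho : gl -> poly -> poly) (rho_osc : is_oscillator rho).

Lemma Gamma_w2_vac f : Gamma_w2 (vac f) = r2 *: excite f + vac f.
Proof. by rewrite Gamma_w2E relax_vac [vac 0]linear0 addr0 vacE eqxx scale1r addrC. Qed.

(** The identity 1/sqrt 2 - sqrt 2 = - 1/sqrt 2 is where the minus sign of the final formulas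
    arises. *)
Lemma sqrt2_scaleB (g : poly) : r2^-1 *: g - r2 *: g = - r2^-1 *: g.
Proof.
rewrite -scalerBl; congr (_ *: _); apply: (mulfI sqrt2_neq0).
by rewrite mulrN mulrBr divff ?sqrt2_neq0 // sqrt2_sqr -[2]/(1 + 1) opprD addrA subrr add0r.
Qed.

Lemma Gamma_vacP f :
  [/\ Gamma_w2 (vac f) ix0 = f,
      forall k, Gamma_w2 (vac f) (ixl k) = r2 *: (poly_sign f)^`M(k) &
      forall k, Gamma_w2 (vac f) (ixr k) = r2 *: ('X_k * poly_sign f)].
Proof.
rewrite Gamma_w2_vac; split=> [|k|k]; rewrite tensor_linE.
- by rewrite excite0 scaler0 add0r vacE eqxx scale1r.
- by rewrite excite_l vacE ixl0E scale0r addr0.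
- by rewrite excite_r vacE ixr0E scale0r addr0.
Qed.

Lemma sqrt2V_scaleK (g : poly) : r2^-1 *: (r2 *: g) = g.
Proof. by rewrite scalerA mulVf ?scale1r ?sqrt2_neq0. Qed.

Lemma sqrt2_scaleNVK (g : poly) : r2 *: (- r2^-1 *: g) = - g.
Proof. by rewrite scalerA mulrN divff ?scaleN1r ?sqrt2_neq0. Qed.

Lemma tens_rep_Xpos0 k u :
  tens_rep rho (Xpos k) u ix0 = r2^-1 *: ('X_k * u ix0) + poly_sign (u (ixr k)).
Proof.
case: rho_osc => _ rhoX _; rewrite tens_repE rhoX sum_Xpos ix0lE eqxx scale0r add0r.
by rewrite scale1r /ixpar ixr0E eqxx.
Qed.

Lemma tens_rep_Xpos_l k u a : tens_rep rho (Xpos k) u (ixl a) =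
  r2^-1 *: ('X_k * u (ixl a)) + (a == k)%:R *: poly_sign (u ix0).
Proof.
case: rho_osc => _ rhoX _; rewrite tens_repE rhoX sum_Xpos ixlE ixl0E scale0r addr0.
by rewrite /ixpar ixl0E eqxx.
Qed.

Lemma tens_rep_Xpos_r k u a :
  tens_rep rho (Xpos k) u (ixr a) = r2^-1 *: ('X_k * u (ixr a)).
Proof.
case: rho_osc => _ rhoX _; rewrite tens_repE rhoX sum_Xpos ixrlE ixr0E.
by rewrite !scale0r !addr0.
Qed.

Lemma tens_rep_Xneg0 k u :
  tens_rep rho (Xneg k) u ix0 = r2^-1 *: (u ix0)^`M(k) + poly_sign (u (ixl k)).
Proof.
case: rho_osc => _ _ rhoD; rewrite tens_repE rhoD sum_Xneg ix0rE eqxx oppr0 scale0r.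
by rewrite add0r scale1r /ixpar ixl0E eqxx.
Qed.

Lemma tens_rep_Xneg_l k u a :
  tens_rep rho (Xneg k) u (ixl a) = r2^-1 *: (u (ixl a))^`M(k).
Proof.
case: rho_osc => _ _ rhoD; rewrite tens_repE rhoD sum_Xneg ixlrE ixl0E oppr0.
by rewrite !scale0r !addr0.
Qed.

Lemma tens_rep_Xneg_r k u a : tens_rep rho (Xneg k) u (ixr a) =
  r2^-1 *: (u (ixr a))^`M(k) - (a == k)%:R *: poly_sign (u ix0).
Proof.
case: rho_osc => _ _ rhoD; rewrite tens_repE rhoD sum_Xneg ixrE ixr0E scale0r addr0.
by rewrite scaleNr /ixpar ixr0E eqxx.
Qed.

(** In the v_0-coordinate, rho contributes 1/sqrt 2 and T_k contributes - sqrt 2 times x_k f. In the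
    v_a-coordinates, the term T_k v_0 = v_k supplies the Leibniz term of d_a (x_k s f), s being the
    involution; in the others, variables commute. *)
Lemma tens_rep_Xpos_Gamma k f :
  tens_rep rho (Xpos k) (Gamma_w2 (vac f)) = Gamma_w2 (vac (- r2^-1 *: ('X_k * f))).
Proof.
have [u0 ul ur] := Gamma_vacP f; move: (Gamma_w2 (vac f)) u0 ul ur => u u0 ul ur.
have [w0 wl wr] := Gamma_vacP (- r2^-1 *: ('X_k * f)).
move: (Gamma_w2 _) w0 wl wr => w w0 wl wr.
apply: tensorP => [|a|a].
- rewrite tens_rep_Xpos0 u0 ur w0 linearZ /= poly_signMX poly_signK.
  by rewrite scalerN sqrt2_scaleB.
- rewrite tens_rep_Xpos_l u0 ul wl [poly_sign (_ *: _)]linearZ /=.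
  rewrite mderivZ sqrt2_scaleNVK poly_signMX mderivN opprK mderivM mderiv_XU.
  by rewrite -scalerAr sqrt2V_scaleK addrC scaler_nat mulr_natl.
- rewrite tens_rep_Xpos_r ur wr [poly_sign (_ *: _)]linearZ /= -!scalerAr.
  by rewrite sqrt2V_scaleK sqrt2_scaleNVK poly_signMX mulrN opprK mulrCA.
Qed.

(** The roles are exchanged: partial derivatives commute in the v_a-coordinates, and in the
    v_{n+a}-coordinates T_{-k} v_0 = - v_{n+k} removes the Leibniz term of d_k (x_a s f). *)
Lemma tens_rep_Xneg_Gamma k f :
  tens_rep rho (Xneg k) (Gamma_w2 (vac f)) = Gamma_w2 (vac (- r2^-1 *: f^`M(k))).
Proof.
have [u0 ul ur] := Gamma_vacP f; move: (Gamma_w2 (vac f)) u0 ul ur => u u0 ul ur.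
have [w0 wl wr] := Gamma_vacP (- r2^-1 *: f^`M(k)).
move: (Gamma_w2 _) w0 wl wr => w w0 wl wr.
apply: tensorP => [|a|a].
- rewrite tens_rep_Xneg0 u0 ul w0 linearZ /= poly_sign_deriv poly_signK.
  by rewrite scalerN sqrt2_scaleB.
- rewrite tens_rep_Xneg_l ul wl [poly_sign (_ *: _)]linearZ /= !mderivZ.
  by rewrite sqrt2V_scaleK sqrt2_scaleNVK poly_sign_deriv mderivN opprK mderiv_comm.
- rewrite tens_rep_Xneg_r u0 ur wr [poly_sign (_ *: _)]linearZ /= mderivZ.
  rewrite -scalerAr sqrt2V_scaleK sqrt2_scaleNVK poly_sign_deriv mulrN opprK mderivM.
  by rewrite mderiv_XU eq_sym scaler_nat mulr_natl addrAC subrr add0r.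
Qed.

End Oscillator.

End Gamma.

(** * The conjugated action and its characterization on monomials *)

Section Conjugated.
Variables (C : numClosedFieldType) (n : nat).
Local Notation gl := 'M[C]_(1 + (n + n)).
Local Notation poly := {mpoly C[n]}.
Local Notation T := (tensor C n).
Local Notation r2 := (sqrtC (2 : C)).
Variables (rho : gl -> poly -> poly) (rho_osc : is_oscillator rho).
Implicit Types (X : gl) (f : poly) (u : T).

Lemma conj_act_Xpos k f :
  conj_act rho (@Gamma_inv C n) (Xpos k) (vac f) = vac (- r2^-1 *: ('X_k * f)).
Proof. by rewrite /conj_act (tens_rep_Xpos_Gamma rho_osc) Gamma_w2K. Qed.

Lemma conj_act_Xneg k f :
  conj_act rho (@Gamma_inv C n) (Xneg k) (vac f) = vac (- r2^-1 *: f^`M(k)).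
Proof. by rewrite /conj_act (tens_rep_Xneg_Gamma rho_osc) Gamma_w2K. Qed.

Lemma tensor10_vac f : tensor10 (vac f).
Proof. by exists f. Qed.

Lemma tensor10_0 : tensor10 (0 : T).
Proof. by exists 0; rewrite -/(vac 0) linear0. Qed.

Lemma tensor10_linear a u v : tensor10 u -> tensor10 v -> tensor10 (a *: u + v).
Proof. by move=> [f ->] [g ->]; exists (a *: f + g); rewrite -!/(vac _) linearP. Qed.

Lemma conj_act_osp : osp_rep tensor_homog tensor10 (conj_act rho (@Gamma_inv C n)).
Proof.
apply: osp_rep_sub.
- case: rho_osc => rhoP _ _.
  have GP : osp_rep tensor_homog (fun=> True)
      (fun X u => Gamma_inv (tens_rep rho X (Gamma_w2 u))).
    apply: (osp_rep_conj (tens_rep_osp rhoP)).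
    + exact: Gamma_invK.
    + exact: tensor_homog_Gamma_w2.
    + exact: tensor_homog_Gamma_inv.
  exact: GP.
- exact: tensor10_0.
- exact: tensor10_linear.
- by move=> j _ [f ->]; rewrite conj_act_Xpos; apply: tensor10_vac.
- by move=> j _ [f ->]; rewrite conj_act_Xneg; apply: tensor10_vac.
Qed.

Lemma conj_act_monomials (j : 'I_n) (k : 'X_{1..n}) :
  conj_act rho (@Gamma_inv C n) (Xpos j) (tens 'X_[k] v0)
    = - r2^-1 *: tens 'X_[k + U_(j)] v0
  /\ conj_act rho (@Gamma_inv C n) (Xneg j) (tens 'X_[k] v0)
    = - r2^-1 *: ((k j)%:R *: tens 'X_[k - U_(j)] v0).
Proof.
split.
  have := conj_act_Xpos j 'X_[k]; rewrite -mpolyXD addmC vacZ; exact.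
(* For k_j = 0 the truncated exponent [k - U_(j)] is harmless, since its coefficient vanishes. *)
by have := conj_act_Xneg j 'X_[k]; rewrite mderivX vacZ vacZ; exact.
Qed.

Lemma osp_rep_eq_monomials par (act act' : gl -> T -> T) X :
  osp_rep par tensor10 act -> osp_rep par tensor10 act' -> is_osp X ->
  (forall k, act X (vac 'X_[k]) = act' X (vac 'X_[k])) ->
  forall u, tensor10 u -> act X u = act' X u.
Proof.
move=> aP a'P oX e _ [f ->]; rewrite -/(vac f).
(* Linearity with scalar -1 on two zero vectors shows that zero is sent to zero, the base case of
   the induction on polynomials. *)
have act0 b : osp_rep par tensor10 b -> b X 0 = 0.
  move=> bP; have := osp_rep_linearr bP (-1) oX tensor10_0 tensor10_0.
  by rewrite scaler0 addr0 scaleN1r addNr.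
elim/mpolyind: f => [|c m f _ _ IH]; first by rewrite linear0 !act0.
rewrite linearP /= (osp_rep_linearr aP) ?(osp_rep_linearr a'P) //;
  try exact: tensor10_vac.
by rewrite e IH.
Qed.

End Conjugated.

Local Open Scope complex_scope.

Theorem corollary1p4 (R : realType) (n : nat) (n_gt0 : (0 < n)%N)
    (rho : 'M[R[i]]_(1 + (n + n)) -> {mpoly R[i][n]} -> {mpoly R[i][n]})
    (rho_osc : is_oscillator rho) :
  exists Gi : tensor R[i] n -> tensor R[i] n,
    [/\ cancel Gamma_w2 Gi /\ cancel Gi Gamma_w2,
        osp_rep tensor_homog tensor10 (conj_act rho Gi),
        (forall (j : 'I_n) (k : 'X_{1..n}),
            conj_act rho Gi (Xpos j) (tens 'X_[k] v0)
              = - (sqrtC 2)^-1 *: tens 'X_[k + U_(j)] v0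
         /\ conj_act rho Gi (Xneg j) (tens 'X_[k] v0)
              = - (sqrtC 2)^-1 *: ((k j)%:R *: tens 'X_[k - U_(j)] v0))
      & (forall sigma : 'M[R[i]]_(1 + (n + n)) -> tensor R[i] n -> tensor R[i] n,
          osp_rep tensor_homog tensor10 sigma ->
          (forall (j : 'I_n) (k : 'X_{1..n}),
            sigma (Xpos j) (tens 'X_[k] v0)
              = - (sqrtC 2)^-1 *: tens 'X_[k + U_(j)] v0
         /\ sigma (Xneg j) (tens 'X_[k] v0)
              = - (sqrtC 2)^-1 *: ((k j)%:R *: tens 'X_[k - U_(j)] v0)) ->
          forall X u, is_osp X -> tensor10 u -> sigma X u = conj_act rho Gi X u)].
Proof.
exists (@Gamma_inv _ n).
have conjP := conj_act_osp rho_osc.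
have formulas := conj_act_monomials rho_osc.
split=> //; first by split; [apply: Gamma_w2K | apply: Gamma_invK].
move=> sigma sigmaP sigmaE.
(* Uniqueness reduces first to the generators and then, by linearity, to monomials, where both
   actions obey the same formulas. *)
apply: (osp_rep_unique (tensor10_0 _ _) sigmaP conjP) => j u; move: u.
- apply: (osp_rep_eq_monomials sigmaP conjP) => [|k].
    by rewrite Xpos_odd; apply: is_osp_odd.
  exact: etrans (sigmaE j k).1 (esym (formulas j k).1).
- apply: (osp_rep_eq_monomials sigmaP conjP) => [|k].
    by rewrite Xneg_odd; apply: is_osp_odd.
  exact: etrans (sigmaE j k).2 (esym (formulas j k).2).
Qed.
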